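(* Let $\mathbb{D}\subset\mathbb{R}^2$ be the closed unit disk, let $\varphi:\mathbb{D}\to M\subset\mathbb{R}^2$ be a diffeomorphism onto $M=\varphi(\mathbb{D})$, let $n\ge 0$ be an integer, $N=(n+1)(n+2)/2$, and let $\mathcal{S}=\{\bm s_1,\dots,\bm s_N\}\subset\mathbb{D}$ be a set of nodes. Let $Z_0,Z_1,\dots,Z_{N-1}$ be the Zernike circle polynomials of radial order at most $n$, and let $P_j:=Z_j\circ\varphi^{-1}$ on $M$. Then the collocation matrix of the functions $P_j$ at the transferred nodes $\varphi(\bm s_1),\dots,\varphi(\bm s_N)$ satisfies $$\left(P_{i-1}(\varphi(\bm s_j))\right)_{i,j=1}^N=\left(Z_{i-1}(\bm s_j)\right)_{i,j=1}^N=\bm Z_N .$$ In particular, for every $p\in[1,\infty]$, the condition number is invariant: $$\kappa_p\left(\left(P_{i-1}(\varphi(\bm s_j))\right)_{i,j=1}^N\right)=\kappa_p(\bm Z_N).$$ The condition number is likewise invariant for the functions $Q_j(x,y):=q(x,y)P_j(x,y)$ when the factor $q$ (a non-vanishing function on $M$) is constant: in that case, for every $p\in[1,\infty]$, $$\kappa_p\left(\left(Q_{i-1}(\varphi(\bm s_j))\right)_{i,j=1}^N\right)=\kappa_p(\bm Z_N).$$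
   Context: Zernike circle polynomials: for integers $n\ge 0$ and $m$ with $|m|\le n$ and $n-m$ even, define in polar coordinates $$\widetilde Z_n^m(\rho,\theta)=\begin{cases}N_n^m R_n^{|m|}(\rho)\cos(m\theta), & m\ge 0,\\ N_n^m R_n^{|m|}(\rho)\sin(|m|\theta), & m<0,\end{cases}$$ where $$R_n^{|m|}(\rho)=\sum_{i=0}^{(n-|m|)/2}\frac{(-1)^i(n-i)!}{i!\,((n+|m|)/2-i)!\,((n-|m|)/2-i)!}\,\rho^{n-2i},\qquad N_n^m=\sqrt{\frac{2(n+1)}{1+\delta_{m,0}}}.$$ In single-index notation, $\widetilde Z_j=\widetilde Z_n^m$ with $j=\frac{n(n+2)+m}{2}\in\{0,1,2,\dots\}$. The function $Z_j(x,y)$ is $\widetilde Z_j$ written in Cartesian coordinates; it is a polynomial in $x,y$. There are exactly $N=(n+1)(n+2)/2$ Zernike polynomials of radial order at most $n$, namely $Z_0,\dots,Z_{N-1}$. The collocation matrix is $\bm Z_N:=\left(Z_{i-1}(\bm s_j)\right)_{i,j=1}^N$. For an $N\times N$ matrix $\bm A$ and $p\in[1,\infty]$, $\|\bm A\|_p$ is the operator norm induced by the vector $p$-norm and $\kappa_p(\bm A)=\|\bm A\|_p\,\|\bm A^{-1}\|_p$ (with the usual convention $\kappa_p(\bm A)=+\infty$ if $\bm A$ is singular). *)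

(* Defs.v *)
From HB Require Import structures.
From mathcomp Require Import all_boot all_order all_algebra.
From mathcomp Require Import all_classical all_reals all_analysis.
From mathcomp Require Import zify ring lra.

Set Implicit Arguments.
Unset Strict Implicit.
Unset Printing Implicit Defensive.

Import Order.TTheory GRing.Theory Num.Theory.
Import numFieldNormedType.Exports.

Local Open Scope classical_set_scope.
Local Open Scope ring_scope.

Definition zernike_count (n : nat) : nat := (n.+1 * n.+2)./2.

Definition zernike_radial {R : realType} (n k : nat) (rho : R) : R :=
  \sum_(0 <= i < ((n - k)./2).+1)
    (-1) ^+ i * (n - i)`!%:R
      / (i`! * ((n + k)./2 - i)`! * ((n - k)./2 - i)`!)%:R * rho ^+ (n - 2 * i).

Definition zernike_normalization {R : realType} (n : nat) (m : int) : R :=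
  Num.sqrt ((2 * n.+1)%:R / (1 + (m == 0)%:R)).

Definition zernike_polar {R : realType} (n : nat) (m : int) (rho theta : R) : R :=
  zernike_normalization n m * zernike_radial n `|m|%N rho *
    (if 0 <= m then cos (m%:~R * theta) else sin (`|m|%N%:R * theta)).

(* [j |-> (n, m)] inverts the single-index map [j = (n (n + 2) + m) / 2]; see
   [zernike_index_valid] and [zernike_index_unique]. *)
Definition zernike_order (j : nat) : nat :=
  find (fun n => j < zernike_count n)%N (iota 0 j.+1).

Definition zernike_frequency (j : nat) : int :=
  (2 * j)%N%:Z - (zernike_order j * (zernike_order j).+2)%N%:Z.

Definition polar_radius {R : realType} (z : R * R) : R :=
  Num.sqrt (z.1 ^+ 2 + z.2 ^+ 2).

(* At the origin the value of the angle is irrelevant; see [zernike_polarE]. *)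
Definition polar_angle {R : realType} (z : R * R) : R :=
  if 0 <= z.2 then acos (z.1 / polar_radius z) else - acos (z.1 / polar_radius z).

Definition zernike {R : realType} (j : nat) (z : R * R) : R :=
  zernike_polar (zernike_order j) (zernike_frequency j)
    (polar_radius z) (polar_angle z).

(* The Euclidean disk: the norm `|z| of R * R is the sup norm. *)
Definition unit_disk {R : realType} : set (R * R) :=
  [set z | z.1 ^+ 2 + z.2 ^+ 2 <= 1].

(* On a set that need not be open, f is C^1 when it coincides there with a map
   that is C^1 on an open neighbourhood of the set. *)
Definition C1_on {R : realType} (A : set (R * R)) (f : R * R -> R * R) : Prop :=
  exists (U : set (R * R)) (g : R * R -> R * R),
    [/\ open U, A `<=` U, {in A, f =1 g},
        (forall z, U z -> differentiable g z)
      & (forall v z, U z -> {for z, continuous (fun w => 'd g w v)})].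

Definition diffeomorphism {R : realType} (A B : set (R * R))
    (f : R * R -> R * R) : Prop :=
  [/\ set_bij A B f, C1_on A f & C1_on B (pinv A f)].

(* (f_{i-1} (s_j))_{i,j}, with both indices numbered from 0 *)
Definition collocation_matrix {R : realType} (n : nat)
    (f : nat -> R * R -> R) (s : 'I_n -> R * R) : 'M[R]_n :=
  \matrix_(i < n, j < n) f i (s j).

(* meaningful for 1 <= p only *)
Definition vector_pnorm {R : realType} (p : \bar R) (n : nat) (x : 'cV[R]_n) : R :=
  match p with
  | r%:E => (\sum_(i < n) `|x i 0| `^ r) `^ r^-1
  | +oo%E => \big[Num.max/0]_(i < n) `|x i 0|
  | -oo%E => 0
  end.

Definition matrix_pnorm {R : realType} (p : \bar R) (n : nat) (A : 'M[R]_n) : \bar R :=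
  ereal_sup [set (vector_pnorm p (A *m x))%:E | x in
    [set x : 'cV[R]_n | vector_pnorm p x <= 1]].

Definition condition_number {R : realType} (p : \bar R) (n : nat) (A : 'M[R]_n) : \bar R :=
  if A \in unitmx then (matrix_pnorm p A * matrix_pnorm p (invmx A))%E else +oo%E.

Lemma zernike_order_bounds (j : nat) :
  (zernike_order j * (zernike_order j).+1 <= 2 * j <
     (zernike_order j).+1 * (zernike_order j).+2)%N.
Proof.
have hj : has (fun n => j < zernike_count n)%N (iota 0 j.+1).
  apply/hasP; exists j; first by rewrite mem_iota; lia.
  by rewrite /zernike_count; nia.
have lt := hj; rewrite has_find size_iota in lt.
have := nth_find 0%N hj; rewrite -/(zernike_order j) in lt *.
rewrite nth_iota // add0n /zernike_count => up.
apply/andP; split; last by lia.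
case E : (zernike_order j) => [|k] //.
have := @before_find _ 0%N (fun n => j < zernike_count n)%N (iota 0 j.+1) k.
rewrite -/(zernike_order j) E => /(_ (ltnSn k)).
rewrite nth_iota ?add0n /zernike_count; last by lia.
have : ~~ odd (k.+1 * k.+2) by rewrite oddM /=; case: (odd k).
lia.
Qed.

Lemma zernike_index_valid (j : nat) (n := zernike_order j)
    (m := zernike_frequency j) :
  [/\ (`|m| <= n)%N, ~~ odd (n + `|m|) & (2 * j)%N%:Z = (n * n.+2)%N%:Z + m].
Proof.
have := zernike_order_bounds j; rewrite /m /zernike_frequency -/n => b.
have : odd (n * n.+2) = odd n by rewrite oddM /= negbK andbb.
by split; nia.
Qed.

Lemma zernike_index_unique (n j : nat) (m : int) :
  (`|m| <= n)%N -> (2 * j)%N%:Z = (n * n.+2)%N%:Z + m ->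
  zernike_order j = n /\ zernike_frequency j = m.
Proof.
move=> mn jE; have b := zernike_order_bounds j.
have E : zernike_order j = n by nia.
by split=> //; rewrite /zernike_frequency E; lia.
Qed.

Lemma polar_angleE {R : realType} (z : R * R) : 0 < polar_radius z ->
  z.1 = polar_radius z * cos (polar_angle z) /\
  z.2 = polar_radius z * sin (polar_angle z).
Proof.
set r := polar_radius z => r0.
have r2 : r ^+ 2 = z.1 ^+ 2 + z.2 ^+ 2.
  by rewrite sqr_sqrtr // addr_ge0 // sqr_ge0.
have xr : -1 <= z.1 / r <= 1.
  rewrite -ler_norml -[leRHS]normr1 -ler_sqr ?nnegrE // !real_normK ?num_real //.
  by rewrite expr_div_n expr1n ler_pdivrMr ?exprn_gt0 // mul1r r2 lerDl sqr_ge0.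
have c : cos (acos (z.1 / r)) = z.1 / r by rewrite acosK // in_itv.
have s : sin (acos (z.1 / r)) = `|z.2| / r.
  rewrite sin_acos // expr_div_n.
  have -> : 1 - z.1 ^+ 2 / r ^+ 2 = (z.2 / r) ^+ 2.
    by rewrite expr_div_n r2; field; rewrite -r2; nra.
  by rewrite sqrtr_sqr normrM normfV (gtr0_norm r0).
rewrite /polar_angle -/r; case: ifPn => z2.
  by rewrite c s ger0_norm //; split; field; lra.
rewrite cosN sinN c s ltr0_norm; last by rewrite ltNge.
by split; field; lra.
Qed.

Lemma cos_sin_muln {R : realType} (k : nat) (a b : R) :
  cos a = cos b -> sin a = sin b ->
  cos (k%:R * a) = cos (k%:R * b) /\ sin (k%:R * a) = sin (k%:R * b).
Proof.
move=> c s; elim: k => [|k [ck sk]]; first by rewrite !mul0r.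
by rewrite -natr1 !mulrDl !mul1r !cosD !sinD ck sk c s.
Qed.

Lemma zernike_radial0 {R : realType} (n k : nat) :
  (0 < k)%N -> (k <= n)%N -> zernike_radial n k 0 = 0 :> R.
Proof.
move=> k0 kn; rewrite /zernike_radial big_nat big1 // => i /andP[_ ik].
have : (0 < n - 2 * i)%N by move: ik; rewrite ltnS; lia.
by case: (n - 2 * i)%N => // p _; rewrite expr0n mulr0.
Qed.

Lemma zernike_polarE {R : realType} (j : nat) (rho theta : R) : 0 <= rho ->
  zernike j (rho * cos theta, rho * sin theta) =
  zernike_polar (zernike_order j) (zernike_frequency j) rho theta.
Proof.
move=> rho0; rewrite /zernike; set z := (_, _).
have rE : polar_radius z = rho.
  rewrite /polar_radius /= !exprMn -mulrDr cos2Dsin2 mulr1.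
  by rewrite sqrtr_sqr ger0_norm.
have [mn _ _] := zernike_index_valid j; rewrite rE /zernike_polar.
have [rho_gt0|] := ltP 0 rho.
  have /polar_angleE : 0 < polar_radius z by rewrite rE.
  rewrite rE /= => -[/(mulfI (lt0r_neq0 rho_gt0)) c /(mulfI (lt0r_neq0 rho_gt0)) s].
  have [cm sm] := cos_sin_muln `|zernike_frequency j|%N (esym c) (esym s).
  case: ifP => m0; last by rewrite sm.
  by have := cm; rewrite !natr_absz ger0_norm // => ->.
move=> rho_le0; have -> : rho = 0 by apply/eqP; rewrite eq_le rho_le0.
have [m0|m_gt0] := posnP `|zernike_frequency j|%N.
  have -> : zernike_frequency j = 0 by lia.
  by rewrite lexx !mul0r.
by rewrite zernike_radial0 // !mulr0 !mul0r.
Qed.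

(* Main.v *)
Require Import Defs.
From HB Require Import structures.
From mathcomp Require Import all_boot all_order all_algebra.
From mathcomp Require Import all_classical all_reals all_analysis.

Import Order.TTheory GRing.Theory Num.Theory.
Import numFieldNormedType.Exports.

Local Open Scope classical_set_scope.
Local Open Scope ring_scope.

(** Transporting both the functions and the nodes by phi changes no sampled
    value: phi is injective on the disk, so phi^-1 undoes phi at every node and
    (Z_j o phi^-1) (phi (s_i)) = Z_j (s_i). The two collocation matrices are
    therefore the same matrix ([collocation_matrix_transport]).
    Multiplying all the functions by a constant c multiplies the collocation
    matrix by c, and c is nonzero because q does not vanish on M, which contains
    phi (0, 0). The p-norm of vectors is
    absolutely homogeneous, hence so is the operator norm ([matrix_pnormZ]);
    since (c A)^-1 = c^-1 A^-1, the factors |c| and |c|^-1 cancel in the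
    condition number ([condition_numberZ]). *)

Lemma vector_pnormZ (R : realType) (p : \bar R) (n : nat) (c : R)
    (x : 'cV[R]_n) :
  (0 < p)%E -> vector_pnorm p (c *: x) = `|c| * vector_pnorm p x.
Proof.
case: p => [r||] //=; last first.
  move=> _; rewrite (big_morph ( *%R `|c|) (id1 := 0) (op1 := Num.max)).
  - by apply: eq_bigr => i _; rewrite mxE normrM.
  - by move=> a b; rewrite maxr_pMr.
  - by rewrite mulr0.
rewrite lte_fin => r0.
have -> : \sum_(i < n) `|(c *: x) i 0| `^ r =
    `|c| `^ r * \sum_(i < n) `|x i 0| `^ r.
  by rewrite big_distrr; apply: eq_bigr => i _; rewrite mxE normrM powRM.
have sum_ge0 : 0 <= \sum_(i < n) `|x i 0| `^ r.
  by apply: sumr_ge0 => i _; exact: powR_ge0.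
by rewrite powRM ?powR_ge0 // -powRrM mulfV ?gt_eqF // powRr1.
Qed.

Lemma matrix_pnormZ (R : realType) (p : \bar R) (n : nat) (c : R)
    (A : 'M[R]_n) :
  (0 < p)%E -> c != 0 ->
  matrix_pnorm p (c *: A) = (`|c|%:E * matrix_pnorm p A)%E.
Proof.
move=> p0 c0; rewrite /matrix_pnorm -ereal_sup_pZl ?normr_gt0 //.
rewrite image_comp; congr ereal_sup; apply: eq_imagel => x _ /=.
by rewrite -scalemxAl vector_pnormZ // EFinM.
Qed.

(** A nonzero factor preserves invertibility, so the infinite value given to
    singular matrices is respected as well. *)
Lemma condition_numberZ (R : realType) (p : \bar R) (n : nat) (c : R)
    (A : 'M[R]_n) :
  (0 < p)%E -> c != 0 -> condition_number p (c *: A) = condition_number p A.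
Proof.
move=> p0 c0; have cU : c \is a GRing.unit by rewrite unitfE.
rewrite /condition_number unitmxZ //; case: ifPn => // AU.
rewrite invmxZ ?unitmxZ // !matrix_pnormZ ?invr_eq0 // muleACA.
by rewrite -EFinM -normrM mulfV // normr1 mul1e.
Qed.

Lemma collocation_matrix_transport (R : realType) (D : set (R * R))
    (phi : R * R -> R * R) (n : nat) (f : nat -> R * R -> R)
    (s : 'I_n -> R * R) :
  {in D &, injective phi} -> (forall j, s j \in D) ->
  collocation_matrix (fun i => f i \o pinv D phi) (phi \o s) =
  collocation_matrix f s.
Proof.
by move=> phi_inj sD; apply/matrixP => i j; rewrite !mxE /= pinvKV.
Qed.

Lemma collocation_matrixZ (R : realType) (n : nat) (f : nat -> R * R -> R)
    (s : 'I_n -> R * R) (q : R * R -> R) (c : R) :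
  (forall j, q (s j) = c) ->
  collocation_matrix (fun i w => q w * f i w) s = c *: collocation_matrix f s.
Proof. by move=> qc; apply/matrixP => i j; rewrite !mxE qc. Qed.

Theorem proposition4p1 (R : realType) (M : set (R * R)) (phi : R * R -> R * R)
    (n : nat) (s : 'I_(zernike_count n) -> R * R)
    (hphi : diffeomorphism unit_disk M phi)
    (hs : forall j, s j \in unit_disk) :
  let Z := @zernike R in
  let P := fun j : nat => Z j \o pinv unit_disk phi in
  [/\ collocation_matrix P (phi \o s) = collocation_matrix Z s,
      (forall p : \bar R, (1 <= p)%E ->
        condition_number p (collocation_matrix P (phi \o s)) =
        condition_number p (collocation_matrix Z s))
    & (forall q : R * R -> R,
        (forall w, M w -> q w != 0) ->
        (exists c : R, forall w, M w -> q w = c) ->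
        let Q := fun (j : nat) (w : R * R) => q w * P j w in
        forall p : \bar R, (1 <= p)%E ->
          condition_number p (collocation_matrix Q (phi \o s)) =
          condition_number p (collocation_matrix Z s))].
Proof.
case: hphi => -[phiM phi_inj _] _ _ Z P.
have PZ : collocation_matrix P (phi \o s) = collocation_matrix Z s.
  exact: collocation_matrix_transport.
split=> [//|p _|q q0 [c qc] Q p p1]; first by rewrite PZ.
have c0 : c != 0.
  have M0 : M (phi (0, 0)).
    by apply: phiM; rewrite /unit_disk /= expr0n addr0 ler01.
  by rewrite -(qc _ M0) q0.
have qs j : q ((phi \o s) j) = c by apply/qc/phiM/set_mem/hs.
rewrite (collocation_matrixZ _ _ _ _ _ _ qs) PZ condition_numberZ //.
exact: lt_le_trans lte01 p1.
Qed.
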